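(* Let $q$ be a prime power with $q\equiv 1 \pmod 4$ and $q>2809$, and let $n=1+\frac{q-1}{4}$. Then there exists an element of $\mathbb{F}_q$ that cannot be written as $\alpha+\beta$ with $\alpha\in C_5$ and $\beta\in C_n$.
   Context: For a prime power $q$ and an integer $k>1$, an element $a\in\mathbb{F}_q$ is called a $k$-potent if $a^k=a$, and $C_k$ denotes the set of all $k$-potents in $\mathbb{F}_q$. For $n=1+(q-1)/4$, $C_n$ is the set of fourth powers in $\mathbb{F}_q$, including $0$. *)

(* Defs.v *)
From HB Require Import structures.
From mathcomp Require Import all_boot all_order all_algebra all_field.
Set Implicit Arguments. Unset Strict Implicit. Unset Printing Implicit Defensive.
Import GRing.Theory.
Local Open Scope ring_scope.

Definition kpotents (F : finFieldType) (k : nat) : {set F} :=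
  [set a : F | a ^+ k == a].

(* Main.v *)
Require Import Defs.
From HB Require Import structures.
From mathcomp Require Import all_boot all_order all_algebra all_field.
From mathcomp Require Import cyclic ring zify.
Import Order.TTheory GRing.Theory Num.Theory.
Local Open Scope ring_scope.
Set Implicit Arguments. Unset Strict Implicit. Unset Printing Implicit Defensive.

(* Let chi be a character of order 4 of F_q and I a primitive fourth root of
   unity, so that C_5 = {0, 1, I, -1, -I} and C_n is the set where chi is 0 or 1.
   If C_5 + C_n were all of F_q, then for each x outside C_5 some entry of
   u(x) = (chi(x - a))_{a in C_5} would be 1. A linear program yields a real
   function f = 42 + Re (sum_e c_e u^e) on (mu_4)^5 which is <= 0 as soon as
   some u_a = 1, and which only involves exponents e for which sum_x u(x)^e
   reduces to Jacobi sums, hence is O(sqrt q) with a small explicit constant: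
   at most two points; three points with exponent sum divisible by 4 (move one
   of them to infinity); or equal exponents at the four fourth roots of unity
   (the product is then a function of x^4). Since |f| <= 2664
   at the five points of C_5, summing f over F_q gives
   42 q - 1880 sqrt q - 820 <= 5 * 2664, which fails for sqrt q >= 53. *)

(** * Multiplicative characters and primitive roots *)

Definition nontrivial_char (F : finFieldType) (f : F -> algC) : Prop :=
  [/\ f 0 = 0, f 1 = 1, {morph f : x y / x * y} & exists2 a, a != 0 & f a != 1].

Lemma expf_cardB1 (F : finFieldType) (x : F) : x != 0 -> x ^+ (#|F| - 1) = 1.
Proof.
move=> x0; apply: (mulfI x0); rewrite mulr1 -exprS subn1 prednK ?expf_card //.
exact: ltnW (finNzRing_gt1 F).
Qed.

(** The q - 1 nonzero elements are distinct (q-1)-th roots of unity, which forces one of them to be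
    primitive. *)
Lemma finField_prim_root (F : finFieldType) :
  exists g : F, (#|F| - 1).-primitive_root g.
Proof.
have n_gt0 : (0 < #|F| - 1)%N by rewrite subn_gt0 finNzRing_gt1.
have /hasP[g _ prim_g] : has (#|F| - 1).-primitive_root (enum (predC1 (0 : F))).
  apply: has_prim_root; rewrite ?enum_uniq // -?cardE ?cardC1 ?subn1 //.
  by apply/allP => x; rewrite mem_enum unity_rootE -subn1 => x0; rewrite expf_cardB1.
by exists g.
Qed.

(** * Sums of products of shifted characters *)

Section CharacterSums.
Context {F : finFieldType}.
Implicit Types (f h : F -> algC) (a b c x y : F).

(** By multiplicativity the value at a nonzero point is a (q-1)-th root of unity. *)
Lemma nontrivial_char_norm f x : nontrivial_char f -> x != 0 -> `|f x| = 1.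
Proof.
move=> [f0 f1 fM _] x0.
have fX n : f (x ^+ n) = f x ^+ n by elim: n => [|n IHn]; rewrite ?expr0 // !exprS fM IHn.
have n_gt0 : (0 < #|F| - 1)%N by rewrite subn_gt0 finNzRing_gt1.
apply/eqP; rewrite -(pexpr_eq1 n_gt0) ?normr_ge0 // -normrX -fX expf_cardB1 // f1 normr1 //.
Qed.

Lemma nontrivial_char_neq0 f x : nontrivial_char f -> x != 0 -> f x != 0.
Proof. by move=> chf x0; rewrite -normr_eq0 nontrivial_char_norm // oner_neq0. Qed.

Lemma nontrivial_charV f x : nontrivial_char f -> f x^-1 = (f x)^-1.
Proof.
move=> chf; have [f0 f1 fM _] := chf.
have [->|x0] := eqVneq x 0; first by rewrite invr0 f0 invr0.
apply: (mulfI (nontrivial_char_neq0 chf x0)).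
by rewrite -fM !divff ?nontrivial_char_neq0.
Qed.

Lemma nontrivial_char_conj f x : nontrivial_char f -> (f x)^* = f x^-1.
Proof.
move=> chf; rewrite nontrivial_charV //; have [->|x0] := eqVneq x 0.
  by have [-> _ _ _] := chf; rewrite conjC0 invr0.
by rewrite invC_norm nontrivial_char_norm // expr1n invr1 mul1r.
Qed.

(** Scaling the variable by some a with f(a) different from 1 permutes the terms but multiplies the
    sum by f(a). *)
Lemma nontrivial_char_sum f : nontrivial_char f -> \sum_x f x = 0.
Proof.
move=> [f0 f1 fM [a a0 fa1]].
have /eqP : f a * (\sum_x f x) = \sum_x f x.
  rewrite [RHS](reindex_inj (mulfI a0)) big_distrr /=.
  by apply: eq_bigr => x _; rewrite fM.
rewrite -subr_eq0 -{2}[\sum_x f x]mul1r -mulrBl mulf_eq0 subr_eq0 (negPf fa1).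
by move/eqP.
Qed.

Lemma char_sum_shift f a : nontrivial_char f -> \sum_x f (x - a) = 0.
Proof.
move=> chf; rewrite -[RHS](nontrivial_char_sum chf).
by rewrite [RHS](reindex_inj (addIr (- a))).
Qed.

(* The substitution y = (x - a) / (x - b) maps F \ {b} onto F \ {1}. *)
Lemma char_sum_ratio f a b : nontrivial_char f -> a != b ->
  \sum_x f (x - a) * (f (x - b))^* = -1.
Proof.
move=> chf ab; have [f0 f1 fM _] := chf.
have ba0 : b - a != 0 by rewrite subr_eq0 eq_sym.
(* The ratio (x - a) / (x - b) is 1 + (b - a) y with y = 1 / (x - b); the term x = b is 0. *)
have -> : \sum_x f (x - a) * (f (x - b))^* = \sum_(y | y != 0) f (1 + (b - a) * y).
  rewrite (bigD1 b) //= subrr f0 conjC0 mulr0 add0r.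
  rewrite [RHS](reindex_inj (invr_inj : injective (@GRing.inv F))) /=.
  rewrite [RHS](reindex_inj (addIr (- b))) /=.
  apply: eq_big => [x|x xb]; first by rewrite invr_eq0 subr_eq0.
  rewrite nontrivial_char_conj // -fM; congr f.
  have x0 : x - b != 0 by rewrite subr_eq0.
  by apply: (mulIf x0); rewrite divfK // mulrDl mul1r divfK // addrA subrK.
have := nontrivial_char_sum chf.
rewrite (reindex_inj (addrI 1)) (reindex_inj (mulfI ba0)) /= (bigD1 0) //=.
by rewrite mulr0 addr0 f1 => /eqP; rewrite addrC addr_eq0 => /eqP.
Qed.

Lemma char_sum_shift_norm f h (d : F) : nontrivial_char f -> nontrivial_char h ->
  d != 0 -> `|\sum_x f (x - d) * h x| = `|\sum_x f (x - 1) * h x|.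
Proof.
move=> chf chh d0; have [_ _ fM _] := chf; have [_ _ hM _] := chh.
rewrite (reindex_inj (mulfI d0)) /=.
under eq_bigr => x _ do rewrite -{2}[d]mulr1 -mulrBr fM hM mulrACA.
by rewrite -big_distrr /= !normrM !nontrivial_char_norm // !mul1r.
Qed.

(* Write T d for the sum over x of f (x - d) h(x): |T d| is the same for all
   d != 0, and by orthogonality the sum of |T d|^2 over d is q (q - 1). *)
Lemma char_sum_pair f h a b : nontrivial_char f -> nontrivial_char h -> a != b ->
  `|\sum_x f (x - a) * h (x - b)| <= sqrtC #|F|%:R.
Proof.
move=> chf chh ab.
pose T d := \sum_x f (x - d) * h x.
have q_gt1 : 0 < #|F|%:R - 1 :> algC.
  by rewrite subr_gt0 ltr1n finNzRing_gt1.
have -> : \sum_x f (x - a) * h (x - b) = T (a - b).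
  rewrite /T [RHS](reindex_inj (addIr (- b))) /=.
  by apply: eq_bigr => x _; congr (f _ * _); ring.
have Tab d : d != 0 -> `|T d| = `|T 1| by apply: char_sum_shift_norm.
rewrite Tab ?subr_eq0 //.
have sumT : \sum_d `|T d| ^+ 2 = #|F|%:R * (#|F|%:R - 1).
  (* Expanding |T d|^2 and summing over d first leaves the kernel [U], which is q times the identity
     minus the all-ones matrix. The all-ones part contributes nothing because h sums to 0. *)
  pose U x y := \sum_d f (x - d) * (f (y - d))^*.
  have Uxx x : U x x = #|F|%:R - 1.
    rewrite /U (bigD1 x) //= subrr (let: And4 f0 _ _ _ := chf in f0) mul0r add0r.
    rewrite (eq_bigr (fun=> 1)) => [|d dx]; last first.
      by rewrite -normCK nontrivial_char_norm ?expr1n // subr_eq0 eq_sym.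
    rewrite sumr_const cardC1 -subn1 natrB // ltnW // finNzRing_gt1 //.
  have Uxy x y : x != y -> U x y = -1.
    move=> xy; rewrite -(@char_sum_ratio f (- x) (- y) chf) ?eqr_opp //.
    rewrite /U (reindex_inj (oppr_inj : injective (@GRing.opp F))) /=.
    by apply: eq_bigr => d _; rewrite !opprK !(addrC d).
  have -> : \sum_d `|T d| ^+ 2 = \sum_x \sum_y h x * (h y)^* * U x y.
    transitivity (\sum_d \sum_x \sum_y h x * (h y)^* * (f (x - d) * (f (y - d))^*)).
      apply: eq_bigr => d _; rewrite normCK /T rmorph_sum big_distrlr /=.
      apply: eq_bigr => x _; apply: eq_bigr => y _; rewrite rmorphM /=; ring.
    rewrite exchange_big /=; apply: eq_bigr => x _.
    rewrite exchange_big /=; apply: eq_bigr => y _.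
    by rewrite -big_distrr.
  have -> : \sum_x \sum_y h x * (h y)^* * U x y =
      \sum_x (#|F|%:R * `|h x| ^+ 2 - h x * (\sum_y h y)^*).
    apply: eq_bigr => x _; rewrite (bigD1 x) //= Uxx.
    rewrite (eq_bigr (fun y => - (h x * (h y)^* ))) => [|y yx]; last first.
      by rewrite Uxy 1?eq_sym // mulrN1.
    have -> : (\sum_y h y)^* = (h x)^* + \sum_(y | y != x) (h y)^*.
      by rewrite rmorph_sum (bigD1 x).
    by rewrite sumrN -big_distrr /= normCK; ring.
  rewrite nontrivial_char_sum // conjC0.
  under eq_bigr => x _ do rewrite mulr0 subr0.
  rewrite -big_distrr /=; congr (_ * _).
  rewrite (bigD1 0) //= (let: And4 f0 _ _ _ := chh in f0) normr0 expr0n /= add0r.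
  rewrite (eq_bigr (fun=> 1)) => [|x x0]; last by rewrite nontrivial_char_norm ?expr1n.
  by rewrite sumr_const cardC1 -subn1 natrB // ltnW // finNzRing_gt1.
rewrite -(ler_pXn2r (n := 2)) ?nnegrE ?sqrtC_ge0 ?ler0n // sqrtCK.
rewrite -(ler_pM2r q_gt1) -sumT (bigD1 0) //= (eq_bigr (fun=> `|T 1| ^+ 2)) => [|d d0]; last first.
  by rewrite Tab.
rewrite sumr_const cardC1 -[X in _ <= _ + X]mulr_natr -subn1 natrB ?lerDr ?exprn_ge0 //.
by rewrite ltnW // finNzRing_gt1.
Qed.

(* Inverting about c turns the sum into one over two points, from which the
   term at the image of infinity is missing. *)
Lemma char_sum_triple f h k a b c :
  nontrivial_char f -> nontrivial_char h -> nontrivial_char k ->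
  (forall x, x != 0 -> f x * h x * k x = 1) -> a != b -> a != c -> b != c ->
  `|\sum_x f (x - a) * h (x - b) * k (x - c)| <= sqrtC #|F|%:R + 1.
Proof.
move=> chf chh chk fhk ab ac bc.
have [_ _ fM _] := chf; have [_ _ hM _] := chh; have [k0 _ kM _] := chk.
have ca0 : c - a != 0 by rewrite subr_eq0 eq_sym.
have cb0 : c - b != 0 by rewrite subr_eq0 eq_sym.
(* Images of a and b under x |-> 1 / (x - c), which sends infinity to 0. *)
pose a' := - (c - a)^-1; pose b' := - (c - b)^-1.
have ab' : a' != b' by rewrite eqr_opp (inj_eq invr_inj) (inj_eq (addrI c)) eqr_opp.
have -> : \sum_x f (x - a) * h (x - b) * k (x - c) =
    f (c - a) * h (c - b) * ((\sum_y f (y - a') * h (y - b')) - f (- a') * h (- b')).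
  have -> : (\sum_y f (y - a') * h (y - b')) - f (- a') * h (- b') =
      \sum_(y | y != 0) f (y - a') * h (y - b').
    by rewrite (bigD1 0) //= !sub0r addrAC subrr add0r.
  rewrite (bigD1 c) //= subrr k0 mulr0 add0r big_distrr /=.
  rewrite (reindex_inj (addIr c)) (reindex_inj (invr_inj : injective (@GRing.inv F))) /=.
  apply: eq_big => [y|y]; first by rewrite -subr_eq0 addrK invr_eq0.
  rewrite -subr_eq0 addrK invr_eq0 => y0.
  have -> : y^-1 + c - a = y^-1 * ((c - a) * (y - a')).
    by rewrite /a'; field; rewrite ca0 y0.
  have -> : y^-1 + c - b = y^-1 * ((c - b) * (y - b')).
    by rewrite /b'; field; rewrite cb0 y0.
  rewrite !fM !hM.
  (* Each of the three factors carries one y^-1, and together these contribute f h k at y^-1, which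
     is 1. *)
  have := fhk y^-1; rewrite invr_eq0 => /(_ y0) e.
  rewrite -[RHS]mul1r -e; ring.
rewrite !normrM !nontrivial_char_norm // !mul1r.
apply: le_trans (ler_normB _ _) _; apply: lerD; first exact: char_sum_pair.
by rewrite normrM !nontrivial_char_norm ?oppr_eq0 ?invr_eq0 // mulr1.
Qed.

End CharacterSums.

(** * The quartic character and sums over fourth powers *)

(** The index in the list of powers of g is the discrete logarithm, so g^m is sent to z^m when z is
    a (q-1)-th root of unity. *)
Definition log_char (F : finFieldType) (g : F) (z : algC) (x : F) : algC :=
  if x == 0 then 0 else z ^+ index x [seq g ^+ i | i <- iota 0 (#|F| - 1)].

Lemma primCi4 : 4.-primitive_root ('i : algC).
Proof.
rewrite /primitive_root_of_unity; apply/andP; split=> //.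
apply/forallP => -[[|[|[|[|//]]]] lt_i4] /=; rewrite unity_rootE.
- rewrite expr1 eqbF_neg; apply/eqP => i1; have := sqrCi algC.
  by rewrite i1 expr1n => /eqP; rewrite -subr_eq0 opprK -mulr2n pnatr_eq0.
- by rewrite sqrCi eqbF_neg -subr_eq0 -opprD oppr_eq0 -mulr2n pnatr_eq0.
- rewrite exprS sqrCi eqbF_neg; apply/eqP => i1; have := sqrCi algC.
  have -> : 'i = -1 :> algC by rewrite -i1 mulrN1 opprK.
  by rewrite sqrrN expr1n => /eqP; rewrite -subr_eq0 opprK -mulr2n pnatr_eq0.
- by rewrite (exprM _ 2 2) sqrCi sqrrN expr1n !eqxx.
Qed.

Section QuarticCharacter.
Context {F : finFieldType} (g : F) (r : nat).
Context (prim_g : (#|F| - 1).-primitive_root g) (card_F : (#|F| - 1 = 4 * r)%N).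
Implicit Types (z w : algC) (x y : F).

Lemma primgen_neq0 m : g ^+ m != 0.
Proof.
rewrite expf_eq0 negb_and; apply/orP; right; apply/eqP => g0.
have := prim_expr_order prim_g; rewrite g0 expr0n.
by rewrite (gtn_eqF (prim_order_gt0 prim_g)) => /esym/eqP; rewrite oner_eq0.
Qed.

Lemma primgenP x : x != 0 -> exists m, x = g ^+ m.
Proof. by move=> /expf_cardB1/(prim_rootP prim_g)[m ->]; exists m. Qed.

Lemma log_charX z m : z ^+ (#|F| - 1) = 1 -> log_char g z (g ^+ m) = z ^+ m.
Proof.
move=> z1; rewrite /log_char (negPf (primgen_neq0 m)) -(prim_expr_mod prim_g).
have lt_m : (m %% (#|F| - 1) < #|F| - 1)%N by rewrite ltn_mod (prim_order_gt0 prim_g).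
set s := map _ _; have -> : g ^+ (m %% (#|F| - 1)) = nth 0 s (m %% (#|F| - 1)).
  by rewrite (nth_map 0%N) ?size_iota // nth_iota.
rewrite index_uniq ?size_map ?size_iota // ?expr_mod //.
rewrite map_inj_in_uniq ?iota_uniq // => i j; rewrite !mem_iota => /= lt_i lt_j /eqP.
by rewrite (eq_prim_root_expr prim_g) !modn_small // => /eqP.
Qed.

Lemma log_char0 z : log_char g z 0 = 0.
Proof. by rewrite /log_char eqxx. Qed.

Lemma log_charM z w x : log_char g (z * w) x = log_char g z x * log_char g w x.
Proof. by rewrite /log_char; case: ifP => _; rewrite ?mulr0 // exprMn. Qed.

(** The exponent must be positive: at x = 0 a zeroth power would be 1, not 0. *)
Lemma log_char_pow z k x : (0 < k)%N -> log_char g z x ^+ k = log_char g (z ^+ k) x.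
Proof.
by rewrite /log_char; case: ifP => _ k0; rewrite ?expr0n ?gtn_eqF // -!exprM mulnC.
Qed.

Lemma log_char_nontrivial z : z ^+ (#|F| - 1) = 1 -> z != 1 ->
  nontrivial_char (log_char g z).
Proof.
move=> z1 z_neq1; split; first exact: log_char0.
- by rewrite -(expr0 g) log_charX.
- move=> x y; have [->|/primgenP[m ->]] := eqVneq x 0; first by rewrite mul0r log_char0 mul0r.
  have [->|/primgenP[k ->]] := eqVneq y 0; first by rewrite mulr0 log_char0 mulr0.
  by rewrite -exprD !log_charX // exprD.
- by exists g; rewrite -[g]expr1 ?primgen_neq0 // log_charX.
Qed.

Definition quartic : F -> algC := log_char g 'i.

Lemma Ci_order e : ('i ^+ e) ^+ (#|F| - 1) = 1 :> algC.
Proof. by rewrite card_F -exprM mulnCA exprM (prim_expr_order primCi4) expr1n. Qed.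

Lemma Ci_neq1 e : (e %% 4 != 0)%N -> 'i ^+ e != 1 :> algC.
Proof. by rewrite -(prim_order_dvd primCi4). Qed.

Lemma quarticX m : quartic (g ^+ m) = 'i ^+ m.
Proof. by rewrite /quartic log_charX // -['i]expr1 Ci_order. Qed.

Lemma quartic_pow_nontrivial e : (e %% 4 != 0)%N ->
  nontrivial_char (fun x => quartic x ^+ e).
Proof.
move=> e4; have e_gt0 : (0 < e)%N by case: e e4.
have [h0 h1 hM hn] := log_char_nontrivial (Ci_order e) (Ci_neq1 e4).
split; first by rewrite log_char_pow.
- by rewrite log_char_pow.
- by move=> x y; rewrite !log_char_pow.
- by case: hn => a a0 ha; exists a; rewrite // log_char_pow.
Qed.

Lemma prim4 : 4.-primitive_root (g ^+ r).
Proof.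
have r_gt0 : (0 < r)%N by have := prim_order_gt0 prim_g; rewrite card_F; case: (r).
have -> : 4%N = ((#|F| - 1) %/ gcdn r (#|F| - 1))%N by rewrite card_F gcdnMl mulnK.
exact: (exp_prim_root prim_g).
Qed.

Lemma quartic_eq1 x : x != 0 -> quartic x = 1 -> exists y, x = y ^+ 4.
Proof.
move=> /primgenP[m ->]; rewrite quarticX => /eqP; rewrite -(prim_order_dvd primCi4).
by case/dvdnP => k ->; exists (g ^+ k); rewrite exprM.
Qed.

Lemma quartic_pow4 x : x != 0 -> quartic (x ^+ 4) = 1.
Proof.
by move=> /primgenP[m ->]; rewrite -exprM quarticX mulnC exprM (prim_expr_order primCi4) expr1n.
Qed.

Lemma quartic_order x : x != 0 -> quartic x ^+ 4 = 1.
Proof.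
by move=> /primgenP[m ->]; rewrite quarticX -exprM mulnC exprM (prim_expr_order primCi4) expr1n.
Qed.

(** Orthogonality: for nonzero y the geometric sum is 4 or 0 according to whether y is a fourth
    power. At y = 0 only j = 0 survives, as 0^0 = 1, matching the single root 0. *)
Lemma card_fourth_roots y :
  #|[pred x | x ^+ 4 == y]|%:R = \sum_(j < 4) quartic y ^+ j.
Proof.
have [->|y0] := eqVneq y 0.
  rewrite (eq_card (B := pred1 0)) ?card1 => [|x]; last by rewrite !inE expf_eq0.
  by rewrite /quartic log_char0 big_ord_recl expr0 big1 ?addr0 // => j _; rewrite expr0n.
have [chy1|chy1] := eqVneq (quartic y) 1.
  rewrite chy1; under eq_bigr => j _ do rewrite expr1n.
  rewrite sumr_const card_ord; congr _%:R.
  have [x0 def_y] := quartic_eq1 y0 chy1.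
  have x0_neq0 : x0 != 0 by apply: contraNneq y0 => x00; rewrite def_y x00 expr0n.
  (* The fourth roots of y are x0 times the four powers of I = [g ^+ r]. *)
  have inj : injective (fun j : 'I_4 => x0 * (g ^+ r) ^+ j).
    move=> j k /(mulfI x0_neq0)/eqP; rewrite (eq_prim_root_expr prim4) !modn_small //.
    by move/eqP/val_inj.
  rewrite -[RHS]card_ord -(card_codom inj); apply: eq_card => x; rewrite inE.
  apply/eqP/codomP => [x4|[j ->]]; last first.
    by rewrite exprMn (exprAC _ j 4) (prim_expr_order prim4) expr1n mulr1.
  have /(prim_rootP prim4)[j xj] : (x / x0) ^+ 4 = 1.
    by rewrite expr_div_n x4 def_y divff // -def_y.
  by exists j; rewrite -xj mulrC divfK.
have -> : \sum_(j < 4) quartic y ^+ j = 0.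
  have := subrX1 (quartic y) 4; rewrite quartic_order // subrr => /esym/eqP.
  by rewrite mulf_eq0 subr_eq0 (negPf chy1) => /eqP.
rewrite (eq_card0 (A := [pred x | x ^+ 4 == y])) // => x; rewrite inE.
apply/negbTE/eqP => x4; move/eqP: chy1; apply; rewrite -x4; apply: quartic_pow4.
by apply: contraNneq y0 => x0; rewrite -x4 x0 expr0n.
Qed.

Lemma sum_fourth_powers (G : F -> algC) :
  \sum_x G (x ^+ 4) = \sum_(j < 4) \sum_y quartic y ^+ j * G y.
Proof.
rewrite exchange_big /= (partition_big (fun x => x ^+ 4) predT) //=.
apply: eq_bigr => y _; rewrite -big_distrl /= -card_fourth_roots.
rewrite (eq_bigr (fun=> G y)) => [|x /eqP-> //].
by rewrite sumr_const mulr_natl.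
Qed.

(* If chi^k is trivial on the fourth roots of unity it is omega(x^4) for some
   character omega; otherwise the sum vanishes by x |-> I x. *)
Lemma char_sum_quartic k e : (k < 4)%N -> (e %% 4 != 0)%N ->
  `|\sum_x quartic x ^+ k * quartic (x ^+ 4 - 1) ^+ e| <= 4 * sqrtC #|F|%:R.
Proof.
move=> lt_k4 e4; have s_ge0 : 0 <= sqrtC #|F|%:R :> algC by rewrite sqrtC_ge0 ler0n.
have sum4 (T : 'I_4 -> algC) : (forall j, `|T j| <= sqrtC #|F|%:R) ->
    `|\sum_j T j| <= 4 * sqrtC #|F|%:R.
  move=> leT; apply: le_trans (ler_norm_sum _ _ _) _.
  by apply: le_trans (ler_sum _ (fun j _ => leT j)) _; rewrite sumr_const card_ord mulr_natl.
have che := quartic_pow_nontrivial e4.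
have [k0|k_neq0] := eqVneq k 0%N.
  rewrite k0; under eq_bigr => x _ do rewrite mul1r.
  rewrite (sum_fourth_powers (fun y => quartic (y - 1) ^+ e)); apply: sum4 => j.
  have [j0|j_neq0] := eqVneq (val j) 0%N.
    by rewrite /= j0; under eq_bigr => x _ do rewrite mul1r; rewrite (char_sum_shift 1 che) normr0.
  have := char_sum_pair (a := 0) (b := 1) (@quartic_pow_nontrivial j _) che.
  under eq_bigr => x _ do rewrite subr0.
  by apply; rewrite ?modn_small // eq_sym oner_neq0.
have k_gt0 : (0 < k)%N by rewrite lt0n.
have k4 : (k %% 4 != 0)%N by rewrite modn_small.
have [chI|chI] := eqVneq (quartic (g ^+ r) ^+ k) 1; last first.
  suff -> : \sum_x quartic x ^+ k * quartic (x ^+ 4 - 1) ^+ e = 0.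
    by rewrite normr0 mulr_ge0.
  apply/eqP; have Ir0 := primgen_neq0 r.
  have [_ _ chM _] := quartic_pow_nontrivial k4.
  suff : quartic (g ^+ r) ^+ k * (\sum_x quartic x ^+ k * quartic (x ^+ 4 - 1) ^+ e) =
      \sum_x quartic x ^+ k * quartic (x ^+ 4 - 1) ^+ e.
    by move/eqP; rewrite -subr_eq0 -{2}[\sum_x _]mul1r -mulrBl mulf_eq0 subr_eq0 (negPf chI).
  rewrite [RHS](reindex_inj (mulfI Ir0)) big_distrr /=; apply: eq_bigr => x _.
  by rewrite chM exprMn (prim_expr_order prim4) mul1r mulrA.
(* The character omega sends g to z. It is well defined because z^(q-1) = i^(k r) = chi(I)^k = 1. *)
pose z := 4.-root ('i ^+ k : algC).
have z4 : z ^+ 4 = 'i ^+ k by rewrite rootCK.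
have z1 : z ^+ (#|F| - 1) = 1 by rewrite card_F exprM z4 -exprM mulnC exprM -quarticX.
have chk x : quartic x ^+ k = log_char g z (x ^+ 4).
  have [->|/primgenP[m ->]] := eqVneq x 0.
    by rewrite expr0n /quartic !log_char0 expr0n gtn_eqF.
  by rewrite quarticX -!exprM log_charX // mulnC [(m * 4)%N]mulnC !exprM z4.
under eq_bigr => x _ do rewrite chk.
rewrite (sum_fourth_powers (fun y => log_char g z y * quartic (y - 1) ^+ e)).
apply: sum4 => j.
have ch : nontrivial_char (log_char g ('i ^+ j * z)).
  apply: log_char_nontrivial; first by rewrite exprMn z1 Ci_order mulr1.
  (* If chi^j omega were trivial, then i^j z = 1, whose fourth power reads i^k = 1. *)
  apply: contraNneq (Ci_neq1 k4) => zj; rewrite -z4.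
  have := congr1 (fun t => t ^+ 4) zj; rewrite /= exprMn (exprAC _ j 4) (prim_expr_order primCi4).
  by rewrite !expr1n mul1r => ->.
have := char_sum_pair (a := 0) (b := 1) ch che; rewrite eq_sym oner_neq0 => /(_ isT).
congr (`|_| <= _); apply: eq_bigr => x _.
rewrite subr0 mulrA; congr (_ * _).
have [->|j_neq0] := eqVneq (val j) 0%N; first by rewrite !expr0 !mul1r.
by rewrite log_charM log_char_pow ?lt0n.
Qed.

End QuarticCharacter.

(** * The linear programming certificate and its finite checks *)

(* An exponent vector lists the exponents at 0, 1, I, I^2, I^3. *)
Definition support (e : seq nat) : seq nat :=
  [seq a <- iota 0 5 | nth 0%N e a != 0%N].

(* [Some (al, be)] stands for the bound al * sqrt q + be. *)
Definition char_sum_bound (e : seq nat) : option (nat * nat) :=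
  match [seq nth 0%N e a | a <- support e] with
  | [:: _] => Some (0, 0)
  | [:: i; j] => Some (if 4 %| i + j then (0, 1) else (1, 0))
  | [:: i; j; k] => if 4 %| i + j + k then Some (1, 1) else None
  | [:: _, _, _, _ & _] =>
      if all (pred1 (nth 0 e 1)) (behead e) then Some (4, 0) else None
  | [::] => None
  end%N.

Definition exponents (e : seq nat) : bool := (size e == 5) && all (ltn^~ 4) e.

(* An entry (c, k, t) gives the coefficient c to all exponent vectors with
   exponent k at 0 and some permutation of t at the fourth roots of unity. *)
Definition certificate : seq (int * seq (seq nat)) := Eval vm_compute in
  [seq (x.1.1, [seq x.1.2 :: p | p <- permutations x.2]) | x <- [::
    (-90, 0%N, [:: 0; 0; 0; 1]%N); (-51, 0%N, [:: 0; 0; 0; 2]%N);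
    (28, 0%N, [:: 0; 0; 1; 1]%N); (36, 0%N, [:: 0; 0; 1; 2]%N);
    (8, 0%N, [:: 0; 0; 1; 3]%N); (16, 0%N, [:: 0; 0; 2; 2]%N);
    (-24, 0%N, [:: 0; 1; 1; 2]%N); (-24, 0%N, [:: 1; 1; 1; 1]%N);
    (6, 0%N, [:: 2; 2; 2; 2]%N); (-128, 1%N, [:: 0; 0; 0; 0]%N);
    (30, 1%N, [:: 0; 0; 0; 1]%N); (38, 1%N, [:: 0; 0; 0; 2]%N);
    (18, 1%N, [:: 0; 0; 0; 3]%N); (-12, 1%N, [:: 0; 0; 1; 2]%N);
    (-24, 1%N, [:: 2; 2; 2; 2]%N); (24, 1%N, [:: 3; 3; 3; 3]%N);
    (-58, 2%N, [:: 0; 0; 0; 0]%N); (18, 2%N, [:: 0; 0; 0; 1]%N);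
    (13, 2%N, [:: 0; 0; 0; 2]%N); (-12, 2%N, [:: 0; 0; 1; 1]%N);
    (-30, 2%N, [:: 2; 2; 2; 2]%N)]].

Definition Re_i_pow (m : nat) : int := nth 0 [:: 1; 0; -1; 0] (m %% 4).

Definition dot (e n : seq nat) : nat :=
  sumn [seq (nth 0 e a * nth 0 n a)%N | a <- iota 0 5].

(** This is f at the point of (mu_4)^5 with coordinates i^(n_a), where u^e is i to the power
    [dot e n]. *)
Definition certificate_value (n : seq nat) : int :=
  42 + foldr +%R 0 [seq x.1 * foldr +%R 0 [seq Re_i_pow (dot e n) | e <- x.2]
                   | x <- certificate].

(** The triangle inequality bound on the nonconstant part of f when each monomial u^e is bounded by
    w(e). *)
Definition certificate_cost (w : seq nat -> nat) : nat :=
  sumn [seq (`|x.1| * sumn [seq w e | e <- x.2])%N | x <- certificate].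

Fixpoint words (k : nat) : seq (seq nat) :=
  if k is k'.+1 then [seq i :: n | i <- iota 0 4, n <- words k'] else [:: [::]].

Lemma mem_words n : all (ltn^~ 4%N) n -> n \in words (size n).
Proof.
elim: n => [//|i n IHn] /andP[lt_i4 /IHn n_in].
by apply/flatten_mapP; exists i; rewrite ?mem_iota // map_f.
Qed.

(** A zero entry of n means that some coordinate u_a is 1. All 4^5 points are checked by
    computation. *)
Lemma certificate_value_le0 n : size n = 5%N -> all (ltn^~ 4%N) n -> 0%N \in n ->
  certificate_value n <= 0.
Proof.
move=> sz_n lt_n4 n0.
have /allP/(_ n) : all (fun n => (0%N \in n) ==> (certificate_value n <= 0)) (words 5).
  by vm_compute.
by rewrite -sz_n mem_words // => /(_ isT); rewrite n0.
Qed.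

Lemma certificate_exponents :
  all (fun x => all (fun e => exponents e && isSome (char_sum_bound e)) x.2) certificate.
Proof. by vm_compute. Qed.

(** The first two totals are the coefficient of sqrt q and the constant in the error term. The third
    is the sum of all |c_e|, whence f <= 42 + 2622 = 2664. *)
Lemma certificate_costs :
  [/\ certificate_cost (fun e => (odflt (0, 0) (char_sum_bound e)).1%N) = 1880%N,
      certificate_cost (fun e => (odflt (0, 0) (char_sum_bound e)).2%N) = 820%N &
      certificate_cost (fun=> 1%N) = 2622%N].
Proof. by vm_compute. Qed.

(** * Summing the certificate over the field *)

Section CertificateSums.
Context {F : finFieldType} (g : F) (r : nat).
Context (prim_g : (#|F| - 1).-primitive_root g) (card_F : (#|F| - 1 = 4 * r)%N).

(** With I = [g ^+ r], the order is that of the entries of an exponent vector. *)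
Definition potents5 : seq F := 0 :: [seq (g ^+ r) ^+ i | i <- iota 0 4].

Definition char_monomial (e : seq nat) (x : F) : algC :=
  \prod_(a <- iota 0 5) quartic g (x - nth 0 potents5 a) ^+ nth 0%N e a.

Lemma potents5_uniq : uniq potents5.
Proof.
have prim_I := prim4 prim_g card_F.
rewrite cons_uniq; apply/andP; split.
  by apply/mapP => -[i _ /eqP]; rewrite eq_sym -exprM (negPf (primgen_neq0 prim_g _)).
rewrite map_inj_in_uniq ?iota_uniq // => i j; rewrite !mem_iota => /= lt_i lt_j /eqP.
by rewrite (eq_prim_root_expr prim_I) !modn_small // => /eqP.
Qed.

Lemma mem_potents5 x : (x \in potents5) = (x \in kpotents F 5).
Proof.
have prim_I := prim4 prim_g card_F.
have -> : (x \in kpotents F 5) = (x == 0) || (x ^+ 4 == 1).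
  rewrite inE -subr_eq0; have -> : x ^+ 5 - x = x * (x ^+ 4 - 1) by ring.
  by rewrite mulf_eq0 subr_eq0.
rewrite inE; congr (_ || _); apply/mapP/eqP => [[i _ ->]|x4].
  by rewrite exprAC (prim_expr_order prim_I) expr1n.
by have [i ->] := prim_rootP prim_I x4; exists (val i); rewrite // mem_iota /= add0n.
Qed.

(** Factors with exponent 0 equal 1 even where the character vanishes, because 0^0 = 1. *)
Lemma char_monomial_support e x : char_monomial e x =
  \prod_(a <- support e) quartic g (x - nth 0 potents5 a) ^+ nth 0%N e a.
Proof.
rewrite /char_monomial /support big_filter [LHS](bigID (fun a => nth 0%N e a != 0%N)) /=.
by rewrite [X in _ * X]big1 ?mulr1 // => a; rewrite negbK => /eqP->.
Qed.

(** The size of the support selects the estimate: shift, pair or ratio, triple, or the sum over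
    fourth powers. *)
Lemma char_monomial_sum e al be : exponents e -> char_sum_bound e = Some (al, be) ->
  `|\sum_x char_monomial e x| <= al%:R * sqrtC #|F|%:R + be%:R.
Proof.
move=> /andP[/eqP sz_e /allP lt_e4].
under eq_bigr => x _ do rewrite char_monomial_support.
have supp_uniq : uniq (support e) by rewrite filter_uniq ?iota_uniq.
have supp_lt a : a \in support e -> (a < 5)%N by rewrite mem_filter mem_iota => /andP[].
have supp_ch a : a \in support e ->
    nontrivial_char (fun x : F => quartic g x ^+ nth 0%N e a).
  rewrite mem_filter mem_iota => /andP[e_a lt_a5]; apply: (quartic_pow_nontrivial prim_g card_F).
  by rewrite modn_small //; apply: lt_e4; rewrite mem_nth ?sz_e.
have pts_neq a b : a \in support e -> b \in support e -> a != b ->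
    nth 0 potents5 a != nth 0 potents5 b.
  by move=> /supp_lt a5 /supp_lt b5; rewrite (nth_uniq 0 _ _ potents5_uniq).
rewrite /char_sum_bound; case def_s : (support e) => [|a [|b [|c [|d s]]]] //=;
  rewrite def_s /= in supp_uniq supp_ch pts_neq *.
- case=> <- <-; under eq_bigr => x _ do rewrite big_seq1.
  rewrite (char_sum_shift _ (supp_ch a _)) ?mem_head // normr0.
  by rewrite mul0r addr0.
- have [a_in b_in] : a \in [:: a; b] /\ b \in [:: a; b] by rewrite !inE !eqxx orbT.
  have ab : a != b by move: supp_uniq; rewrite inE andbT.
  under eq_bigr => x _ do rewrite !big_cons big_nil mulr1.
  case: ifP => [dvd4|_] [<- <-]; last first.
    rewrite mul1r addr0.
    by apply: (char_sum_pair (supp_ch a a_in) (supp_ch b b_in)); apply: pts_neq.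
  rewrite mul0r add0r.
  have := char_sum_ratio (supp_ch a a_in) (pts_neq _ _ a_in b_in ab).
  set S := (X in X = _ -> _); set S' := (X in `|X| <= _) => S1.
  (* When the two exponents sum to a multiple of 4, the second character is the conjugate of the
     first. *)
  suff -> : S' = S by rewrite S1 normrN normr1.
  apply: eq_bigr => x _; congr (_ * _).
  have [->|x0] := eqVneq (x - nth 0 potents5 b) 0.
    have [h0 _ _ _] := supp_ch a a_in; have [k0 _ _ _] := supp_ch b b_in.
    by rewrite h0 k0 conjC0.
  have nz : quartic g (x - nth 0 potents5 b) ^+ nth 0%N e a != 0.
    exact: nontrivial_char_neq0 (supp_ch a a_in) x0.
  apply: (mulfI nz); rewrite -exprD -normCK.
  rewrite (nontrivial_char_norm (supp_ch a a_in) x0) expr1n.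
  by case/dvdnP: dvd4 => m ->; rewrite mulnC exprM (quartic_order prim_g card_F) ?expr1n.
- have [a_in [b_in c_in]] : a \in [:: a; b; c] /\ b \in [:: a; b; c] /\ c \in [:: a; b; c].
    by rewrite !inE !eqxx !orbT.
  have [ab ac bc] : [/\ a != b, a != c & b != c].
    by move: supp_uniq; rewrite !inE negb_or andbT => /andP[/andP[-> ->] ->].
  under eq_bigr => x _ do rewrite !big_cons big_nil mulr1 mulrA.
  case: ifP => // dvd4 [<- <-]; rewrite mul1r.
  apply: (char_sum_triple (supp_ch a a_in) (supp_ch b b_in) (supp_ch c c_in)).
  + move=> x x0; rewrite -!exprD.
    by case/dvdnP: dvd4 => m ->; rewrite mulnC exprM (quartic_order prim_g card_F) ?expr1n.
  + exact: pts_neq.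
  + exact: pts_neq.
  + exact: pts_neq.
- case: ifP => // all_e [<- <-]; rewrite addr0.
  have [k [j def_e]] : exists k j, e = [:: k; j; j; j; j].
    case: (e) sz_e all_e => [|k [|j [|? [|? [|? [|//]]]]]] //= _.
    by move=> /and5P[_ /eqP-> /eqP-> /eqP-> _]; exists k, j.
  have k4 : (k < 4)%N by apply: lt_e4; rewrite def_e mem_head.
  (* With j = 0 the support would have at most one point, but here it has at least four. *)
  have j4 : (j %% 4 != 0)%N.
    rewrite modn_small; last by apply: lt_e4; rewrite def_e !inE eqxx /= orbT.
    apply/eqP => j0; move: def_s; rewrite def_e j0 /support /=.
    by case: (k).
  apply: le_trans (char_sum_quartic prim_g card_F k4 j4).
  rewrite le_eqVlt; apply/orP; left; apply/eqP; congr `|_|.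
  apply: eq_bigr => x _; rewrite -def_s -char_monomial_support def_e /char_monomial.
  rewrite big_cons /= subr0; congr (_ * _).
  have [_ _ chM _] := quartic_pow_nontrivial prim_g card_F j4.
  (* The equal exponents at the fourth roots of unity merge into one character of x^4 - 1. *)
  have -> : x ^+ 4 - 1 = \prod_(i <- iota 0 4) (x - (g ^+ r) ^+ i).
    have := congr1 (horner^~ x) (factor_Xn_sub_1 (prim4 prim_g card_F)).
    rewrite /= hornerD hornerN hornerXn hornerC horner_prod => <-.
    by rewrite /index_iota subn0; apply: eq_bigr => i _; rewrite hornerXsubC.
  by rewrite !big_cons !big_nil !mulr1 !chM.
Qed.

Lemma char_monomial_norm_le1 e x : `|char_monomial e x| <= 1.
Proof.
rewrite /char_monomial normr_prod; apply: prodr_ile1 => a _.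
rewrite normr_ge0 normrX exprn_ile1 //.
have [->|x0] := eqVneq (x - nth 0 potents5 a) 0.
  by rewrite /quartic log_char0 normr0 ler01.
have /nontrivial_char_norm -/(_ _ x0) := quartic_pow_nontrivial prim_g card_F (e := 1) isT.
by rewrite expr1 => ->.
Qed.


Lemma Re_Ci_pow m : 'Re ('i ^+ m) = (Re_i_pow m)%:~R :> algC.
Proof.
rewrite -(prim_expr_mod primCi4) /Re_i_pow.
have : (m %% 4 < 4)%N by rewrite ltn_mod.
case: (m %% 4)%N => [|[|[|[|//]]]] _ /=.
- by rewrite expr0 (Creal_ReP _ _) ?rpred1.
- by rewrite expr1 Re_i.
- by rewrite sqrCi (Creal_ReP _ _) ?rpredN1.
- by rewrite exprS sqrCi mulrN1 raddfN /= Re_i oppr0.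
Qed.

Definition certificate_function (x : F) : algC :=
  42 + \sum_(t <- certificate) t.1%:~R * \sum_(e <- t.2) 'Re (char_monomial e x).

Lemma certificate_functionE x n : size n = 5%N ->
  (forall a, (a < 5)%N -> quartic g (x - nth 0 potents5 a) = 'i ^+ nth 0%N n a) ->
  certificate_function x = (certificate_value n)%:~R.
Proof.
move=> sz_n def_n; rewrite /certificate_function /certificate_value intrD.
congr (_ + _); rewrite foldrE big_map rmorph_sum; apply: eq_bigr => t _.
rewrite rmorphM; congr (_ * _); rewrite foldrE big_map rmorph_sum.
apply: eq_bigr => e _; rewrite -[RHS]/((Re_i_pow _)%:~R) -Re_Ci_pow.
rewrite /dot sumnE big_map expr_sum; congr ('Re _).
rewrite /char_monomial big_seq [RHS]big_seq; apply: eq_bigr => a.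
by rewrite mem_iota => /def_n ->; rewrite -exprM mulnC.
Qed.

Lemma certificate_function_le x : certificate_function x <= 2664.
Proof.
have -> : 2664 = 42 + (certificate_cost (fun=> 1%N))%:R :> algC.
  by have [_ _ ->] := certificate_costs; rewrite -natrD.
rewrite lerD2l /certificate_cost sumnE big_map natr_sum; apply: ler_sum => t _.
apply: le_trans (real_ler_norm _) _.
  by rewrite rpredM ?rpred_sum ?realz // => e _; rewrite Creal_Re.
rewrite normrM natrM natr_absz intr_norm ler_wpM2l ?normr_ge0 //.
rewrite sumnE big_map natr_sum; apply: le_trans (ler_norm_sum _ _ _) _.
apply: ler_sum => e _; apply: le_trans (char_monomial_norm_le1 e x).
exact: leif_normC_Re_Creal.
Qed.

(** The constant term gives 42 q. After exchanging sums, the rest is controlled monomial by monomial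
    through [char_monomial_sum]. *)
Lemma certificate_function_sum :
  42 * #|F|%:R - 1880 * sqrtC #|F|%:R - 820 <= \sum_x certificate_function x.
Proof.
rewrite big_split /= sumr_const mulr_natr -addrA lerD2l -opprD.
rewrite exchange_big /= lerNl; apply: le_trans (real_ler_norm _) _.
  rewrite rpredN rpred_sum // => t _; rewrite rpred_sum // => x _.
  by rewrite rpredM ?realz ?rpred_sum // => e _; rewrite Creal_Re.
have [c1 c2 _] := certificate_costs; rewrite -c1 -c2 normrN.
apply: le_trans (ler_norm_sum _ _ _) _.
rewrite /certificate_cost !sumnE !big_map !natr_sum big_distrl -big_split /=.
rewrite big_seq [leRHS]big_seq; apply: ler_sum => t t_in.
have /allP ok := allP certificate_exponents t t_in.
rewrite -big_distrr normrM !natrM natr_absz intr_norm -mulrA -mulrDr.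
rewrite ler_wpM2l ?normr_ge0 // !sumnE !big_map !natr_sum big_distrl -big_split /=.
rewrite exchange_big /=; apply: le_trans (ler_norm_sum _ _ _) _.
rewrite big_seq [leRHS]big_seq; apply: ler_sum => e /ok/andP[e_ok].
case def_b : (char_sum_bound e) => [[al be]|] // _.
rewrite -raddf_sum; apply: le_trans (char_monomial_sum e_ok def_b).
exact: leif_normC_Re_Creal.
Qed.

End CertificateSums.

(** * Numerical margin and conclusion *)

(* In terms of d = sqrt q - 53 >= 0 the gap has nonnegative coefficients. *)
Lemma certificate_margin (q : nat) : (2809 < q)%N ->
  13320 < 42 * q%:R - 1880 * sqrtC q%:R - 820 :> algC.
Proof.
move=> q_gt; pose d : algC := sqrtC q%:R - 53.
have d_ge0 : 0 <= d.
  rewrite subr_ge0 -(ler_pXn2r (n := 2)) ?nnegrE ?sqrtC_ge0 ?ler0n // sqrtCK.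
  have -> : 53 ^+ 2 = 2809%:R :> algC by ring.
  by rewrite ler_nat ltnW.
have def_s : sqrtC q%:R = 53 + d :> algC by rewrite /d addrC subrK.
have -> : q%:R = (53 + d) ^+ 2 :> algC by rewrite -def_s sqrtCK.
have -> : sqrtC ((53 + d) ^+ 2) = 53 + d by rewrite -def_s sqrtCK.
rewrite -subr_gt0.
have -> : 42 * (53 + d) ^+ 2 - 1880 * (53 + d) - 820 - 13320 =
    4198 + (2572 * d + 42 * d ^+ 2) by ring.
apply: ltr_wpDr; last by rewrite ltr0n.
by rewrite addr_ge0 ?mulr_ge0 ?exprn_ge0 ?ler0n.
Qed.

(* F_q is represented by an arbitrary finite field F with q = #|F|. *)
Theorem theorem2p5 (F : finFieldType) :
  (#|F| %% 4 = 1)%N -> (2809 < #|F|)%N ->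
  exists x : F, ~ (exists alpha beta : F,
     alpha \in kpotents F 5 /\
     beta \in kpotents F (1 + (#|F| - 1) %/ 4) /\
     x = alpha + beta).
Proof.
move=> q_mod4 q_gt; have [g prim_g] := finField_prim_root F.
pose r := ((#|F| - 1) %/ 4)%N.
have card_F : (#|F| - 1 = 4 * r)%N.
  by rewrite /r; lia.
(* A point that is not bad is the desired witness, so the remaining case has every point bad. *)
pose bad (x : F) := [exists p in kpotents F 5, x - p \in kpotents F (1 + r)].
have [/forallP all_bad|/forallPn[x x_good]] := boolP [forall x, bad x]; last first.
  exists x => -[p [b [p_in [b_in def_x]]]]; case/negP: x_good.
  by apply/existsP; exists p; rewrite p_in def_x addrC addKr.
exfalso; pose pts := potents5 g r.
have f_le x : certificate_function g r x <= if x \in pts then 2664 else 0.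
  case: ifPn => x_pts; first exact: certificate_function_le.
  have dx_neq0 a : (a < 5)%N -> x - nth 0 pts a != 0.
    move=> lt_a5; rewrite subr_eq0; apply: contraNneq x_pts => ->.
    by rewrite mem_nth.
  (* The logarithms of the coordinates of u(x) to base i. The default 0 is never taken: off C_5 each
     coordinate is a fourth root of unity. *)
  pose n := [seq (if [pick i : 'I_4 | quartic g (x - nth 0 pts a) == 'i ^+ i] is Some i
                  then val i else 0%N) | a <- iota 0 5].
  have nE a : (a < 5)%N -> quartic g (x - nth 0 pts a) = 'i ^+ nth 0%N n a.
    move=> lt_a5; rewrite (nth_map 0%N) ?size_iota // nth_iota // add0n.
    case: pickP => [i /eqP-> //|no_i].
    have [i def_i] := prim_rootP primCi4 (quartic_order prim_g card_F (dx_neq0 a lt_a5)).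
    by have := no_i i; rewrite def_i eqxx.
  have n_lt4 : all (ltn^~ 4%N) n.
    by apply/allP => _ /mapP[a _ ->]; case: pickP => [i _|] //; apply: ltn_ord.
  rewrite (certificate_functionE (n := n)) // ?size_map ?size_iota //.
  rewrite lerz0; apply: certificate_value_le0 => //.
  have /existsP[p /andP[p_in]] := all_bad x.
  rewrite -(mem_potents5 prim_g card_F) in p_in.
  have lt_p : (index p pts < 5)%N by rewrite index_mem.
  have := dx_neq0 _ lt_p; have := nE _ lt_p; rewrite nth_index //.
  (* Cancelling x - p = g^m leaves (x - p)^r = 1, so 4 r divides m r and 4 divides m. Hence chi(x -
     p) = 1, and the entry of n at p is 0. *)
  move=> chi_n x_neq0; rewrite inE add1n exprS -{3}[x - p]mulr1 => /eqP/(mulfI x_neq0).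
  have [m def_m] := primgenP prim_g x_neq0.
  rewrite def_m -exprM => /eqP; rewrite -(prim_order_dvd prim_g) card_F.
  rewrite dvdn_pmul2r => [m4|]; last by rewrite /r divn_gt0 //; move: q_gt; case: #|F| => // ?; lia.
  move: chi_n; rewrite def_m (quarticX prim_g card_F).
  move/eqP; rewrite (eq_prim_root_expr primCi4) (eqP m4).
  have lt_n4 : (nth 0%N n (index p pts) < 4)%N.
    by apply: (allP n_lt4); rewrite mem_nth // size_map size_iota.
  rewrite modn_small // => /eqP def_0; rewrite {1}def_0.
  by rewrite mem_nth // size_map size_iota.
have := certificate_margin q_gt; apply/negP.
rewrite -real_leNgt ?rpredB ?rpredM ?realn //; last first.
  by rewrite ger0_real // sqrtC_ge0 ler0n.
apply: le_trans (certificate_function_sum prim_g card_F) _.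
apply: le_trans (ler_sum _ (fun x _ => f_le x)) _.
rewrite -big_mkcond /= sumr_const -[leLHS]mulr_natr.
(* Only the five points of C_5 contribute to the upper bound, at most 2664 each. *)
have -> : 13320 = 2664 * 5 :> algC by ring.
rewrite ler_wpM2l ?ler0n // ler_nat; exact: card_size.
Qed.
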